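(* Let $\mathrm{k}$ be a commutative $\mathbb{Q}$-algebra, let $\lambda\in\mathrm{k}$, let $A$ be a $\mathrm{k}$-algebra, and let $\ell\in\mathbb{N}\cup\{\infty\}$. Then: (i) There is a $\mathrm{k}$-algebra morphism $\hat\lambda\colon (A^\ell,\cdot^\lambda)\to(A^\ell,\cdot^1)$ defined by $\hat\lambda(a)_n=\lambda^n a_n$. (ii) There is a $\mathrm{k}$-algebra isomorphism $\theta_\ell\colon(A^\ell,\cdot^1)\to(A^\ell,\text{pointwise})$ defined by $\theta_\ell(a)_n=\sum_m\binom{n}{m}a_m$. (iii) There is a $\mathrm{k}$-algebra morphism $\gamma_\ell\colon(A^\ell,\cdot^\lambda)\to(A^\ell,\text{pointwise})$ defined by $\gamma_\ell(a)_n=\sum_m\binom{n}{m}\lambda^m a_m$, which is an isomorphism whenever $\lambda$ is invertible in $\mathrm{k}$.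
   Context: Algebras are associative and unital, not necessarily commutative. For $\ell\in\mathbb{N}\cup\{\infty\}$, $A^\ell$ is the $\mathrm{k}$-module of sequences $(a_n)_{0\le n<\ell}$ in $A$ (so $A^\infty=A^{\mathbb{N}}$). The $\lambda$-weighted Hurwitz product on $A^\ell$ is, for $0\le n<\ell$, $$(a\cdot^\lambda b)_n=\sum_{r+s+t=n}\binom{n}{r,s,t}\lambda^t a_{r+t}b_{s+t},\qquad \binom{n}{r,s,t}=\frac{n!}{r!\,s!\,t!},\ r,s,t\in\mathbb{N},$$ with unit $(1,0,0,\dots)$; with the pointwise linear structure this makes $(A^\ell,\cdot^\lambda)$ a $\mathrm{k}$-algebra. The product $\cdot^1$ is the case $\lambda=1$. $(A^\ell,\text{pointwise})$ is $A^\ell$ with componentwise multiplication and unit $(1,1,1,\dots)$. As usual $\binom{n}{m}=0$ for $m>n$. *)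

(* Defs.v *)
From HB Require Import structures.
From mathcomp Require Import all_boot all_algebra.
From mathcomp Require Import boolp functions.

Set Implicit Arguments.
Unset Strict Implicit.
Unset Printing Implicit Defensive.

Import GRing.Theory.
Local Open Scope ring_scope.

(* algType requires 1 != 0, which A^0 fails, and Hierarchy Builder does not    *)
(* allow a possibly-zero join of PzRing and Lmodule to be added above it, so   *)
(* possibly-zero algebras are packed by hand.                                  *)
Record algebra_structure (R : comPzRingType) (A : pzRingType) := AlgebraStructure {
  algebra_lmod : GRing.Nmodule_isLSemiModule R A;
  algebra_scale := GRing.Nmodule_isLSemiModule.scale algebra_lmod;
  algebra_scaleAl : forall c (x y : A),
    algebra_scale c (x * y) = algebra_scale c x * y;
  algebra_scaleAr : forall c (x y : A),
    algebra_scale c (x * y) = x * algebra_scale c y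
}.

Record pzAlgebra (R : comPzRingType) := PzAlgebra {
  pzalg_ring : pzRingType;
  pzalg_structure : algebra_structure R pzalg_ring
}.

Definition pzalg_sort (R : comPzRingType) (A : pzAlgebra R) : Type :=
  pzalg_ring A.
Coercion pzalg_sort : pzAlgebra >-> Sortclass.

HB.instance Definition _ (R : comPzRingType) (A : pzAlgebra R) :=
  GRing.PzRing.copy (pzalg_sort A) (pzalg_ring A).
HB.instance Definition _ (R : comPzRingType) (A : pzAlgebra R) :
    GRing.Nmodule_isLSemiModule R (pzalg_sort A) :=
  algebra_lmod (pzalg_structure A).

Lemma pzscalerAl (R : comPzRingType) (A : pzAlgebra R) c (x y : A) :
  c *: (x * y) = c *: x * y.
Proof. exact: (algebra_scaleAl (pzalg_structure A) c x y). Qed.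

Lemma pzscalerAr (R : comPzRingType) (A : pzAlgebra R) c (x y : A) :
  c *: (x * y) = x * (c *: y).
Proof. exact: (algebra_scaleAr (pzalg_structure A) c x y). Qed.

Definition is_algebra_morphism (R : comPzRingType) (A B : pzAlgebra R)
  (f : A -> B) : Prop := linear f /\ monoid_morphism f.

Definition is_algebra_isomorphism (R : comPzRingType) (A B : pzAlgebra R)
    (f : A -> B) : Prop :=
  is_algebra_morphism f /\
  exists g : B -> A, [/\ is_algebra_morphism g, cancel f g & cancel g f].

(* The elements l of N + {oo} are encoded in option nat, with None for oo.     *)
Definition below (l : option nat) (n : nat) : bool :=
  if l is Some m then (n < m)%N else true.

Definition position (l : option nat) : Type := {n : nat | below l n}.

Definition position_val (l : option nat) (n : position l) : nat := val n.
Coercion position_val : position >-> nat.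

Definition sequence (A : Type) (l : option nat) : Type := position l -> A.

(* Only entries a_m with m <= n < l are ever used, so the value 0 outside the  *)
(* range is irrelevant.                                                        *)
Definition entry (A : nmodType) (l : option nat) (a : sequence A l) (m : nat) : A :=
  if insub m is Some i then a i else 0.

Definition hurwitz_prod (k : comPzRingType) (A : pzAlgebra k) (lambda : k)
    (f g : nat -> A) (n : nat) : A :=
  \sum_(r < n.+1) \sum_(s < n.+1) \sum_(t < n.+1 | (r + s + t == n)%N)
    (lambda ^+ t *: (f (r + t)%N * g (s + t)%N)) *+ (n`! %/ (r`! * s`! * t`!))%N.

Section HurwitzTheory.
Variables (k : comPzRingType) (A : pzAlgebra k) (lambda : k).
Implicit Types (f g h : nat -> A) (n : nat).
Local Notation H := (hurwitz_prod lambda).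

Let binsum (G : nat -> nat -> A) n : A :=
  \sum_(i < n.+1) G (n - i)%N i *+ 'C(n, i).

Let binsum0 G : binsum G 0 = G 0%N 0%N.
Proof. by rewrite /binsum big_ord1 subn0 bin0 mulr1n. Qed.

Let binsumS G n : binsum G n.+1 =
  binsum (fun p q => G p.+1 q) n + binsum (fun p q => G p q.+1) n.
Proof.
rewrite /binsum big_ord_recl bin0 subn0 /=.
under eq_bigr => i _ do rewrite /bump /= add1n subSS binS mulrnDr.
rewrite big_split /= addrA; congr (_ + _).
rewrite big_ord_recr /= bin_small // mulr0n addr0.
rewrite [RHS]big_ord_recl /= bin0 subn0; congr (_ + _).
apply: eq_bigr => i _; rewrite /bump /= add1n.
by rewrite -subSn ?subSS // ltn_ord.
Qed.

Let eq_binsum G G' n : (forall p q, (p + q = n)%N -> G p q = G' p q) ->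
  binsum G n = binsum G' n.
Proof.
by move=> GG'; apply: eq_bigr => i _; rewrite GG' // subnK // -ltnS.
Qed.

Let binsumD G G' n :
  binsum (fun p q => G p q + G' p q) n = binsum G n + binsum G' n.
Proof. by rewrite /binsum -big_split; apply: eq_bigr => i _; rewrite mulrnDl. Qed.

Let trisum (F : nat -> nat -> nat -> A) n :=
  binsum (fun p t => binsum (fun r s => F r s t) p) n.

Let trisumS F n : trisum F n.+1 =
  trisum (fun r s t => F r.+1 s t) n + trisum (fun r s t => F r s.+1 t) n +
  trisum (fun r s t => F r s t.+1) n.
Proof.
rewrite /trisum binsumS; congr (_ + _).
by rewrite -binsumD; apply: eq_binsum => p q _; rewrite binsumS.
Qed.

Let multinomialE n (r s t : nat) : (r + s + t)%N = n ->
  (n`! %/ (r`! * s`! * t`!) = 'C(n, t) * 'C(n - t, s))%N.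
Proof.
move=> <-; rewrite addnK -{1}(bin_fact (leq_addl (r + s) t)) addnK.
rewrite -(bin_fact (leq_addl r s)) addnK.
have -> : ('C(r + s + t, t) * (t`! * ('C(r + s, s) * (s`! * r`!))) =
  'C(r + s + t, t) * 'C(r + s, s) * (r`! * s`! * t`!))%N.
  rewrite -!mulnA; congr (_ * _)%N; rewrite mulnCA; congr (_ * _)%N.
  by rewrite mulnA mulnC (mulnC s`!).
by rewrite mulnK // !muln_gt0 !fact_gt0.
Qed.

Let hurwitzE f g n :
  H f g n = trisum (fun r s t => lambda ^+ t *: (f (r + t)%N * g (s + t)%N)) n.
Proof.
rewrite /hurwitz_prod /trisum /binsum.
under eq_bigr => r _ do under eq_bigr => s _ do rewrite big_mkcond.
under eq_bigr => r _ do rewrite exchange_big.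
rewrite exchange_big /=; apply: eq_bigr => t _; rewrite exchange_big /=.
rewrite -sumrMnl (big_ord_widen_cond n.+1 predT (fun s =>
  (lambda ^+ t *: (f (n - t - s + t)%N * g (s + t)%N)) *+ 'C(n - t, s) *+ 'C(n, t)));
  last by rewrite ltnS leq_subr.
rewrite [RHS]big_mkcond /=; apply: eq_bigr => s _; rewrite -big_mkcond /=.
case: ltnP => [lt_s|ge_s]; last first.
  rewrite big_pred0 // => r; apply/negbTE/eqP => e; move: ge_s.
  by rewrite -(congr1 (subn^~ t) e) addnK ltnNge leq_addl.
have lt_r : (n - t - s < n.+1)%N by rewrite ltnS -subnDA leq_subr.
rewrite (big_pred1 (Ordinal lt_r)) /=; last first.
  move=> r; transitivity (val r == n - t - s)%N; last by [].
  have le_t : (t <= n)%N by rewrite -ltnS.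
  by rewrite -[RHS](eqn_add2r s) subnK // -[RHS](eqn_add2r t) subnK.
rewrite multinomialE; last by rewrite /= subnK // subnK // -ltnS.
by rewrite mulnC mulrnA.
Qed.

Lemma hurwitz_prod_at0 f g : H f g 0 = f 0 * g 0.
Proof. by rewrite hurwitzE /trisum !binsum0 expr0 scale1r. Qed.

(* With f' the shift of f: (f g)' = f' g + f g' + lambda f' g'.                *)
Lemma hurwitz_prodS f g n : H f g n.+1 =
  H (f \o succn) g n + H f (g \o succn) n + lambda *: H (f \o succn) (g \o succn) n.
Proof.
rewrite !hurwitzE trisumS; congr (_ + _ + _).
  rewrite /trisum /binsum scaler_sumr; apply: eq_bigr => t _.
  rewrite -scalerMnr scaler_sumr; congr (_ *+ _); apply: eq_bigr => s _.
  by rewrite -scalerMnr scalerA -exprS /= !addnS.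
Qed.

Lemma eq_hurwitz_prod f f' g g' n :
    (forall m, (m <= n)%N -> f m = f' m) ->
    (forall m, (m <= n)%N -> g m = g' m) ->
  H f g n = H f' g' n.
Proof.
move=> ff' gg'; apply: eq_bigr => r _; apply: eq_bigr => s _.
apply: eq_bigr => t /eqP e; rewrite ff' ?gg' //.
  by move: (leq_addl r (s + t)); rewrite addnA e.
by move: (leq_addr s (r + t)); rewrite addnAC e.
Qed.

Lemma hurwitz_prodDl f g h n : H (f \+ g) h n = H f h n + H g h n.
Proof.
rewrite -big_split; apply: eq_bigr => r _.
rewrite -big_split; apply: eq_bigr => s _.
rewrite -big_split; apply: eq_bigr => t _ /=.
by rewrite mulrDl scalerDr mulrnDl.
Qed.

Lemma hurwitz_prodDr f g h n : H f (g \+ h) n = H f g n + H f h n.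
Proof.
rewrite -big_split; apply: eq_bigr => r _.
rewrite -big_split; apply: eq_bigr => s _.
rewrite -big_split; apply: eq_bigr => t _ /=.
by rewrite mulrDr scalerDr mulrnDl.
Qed.

Lemma hurwitz_prodZl c f g n : H (c \*: f) g n = c *: H f g n.
Proof.
rewrite scaler_sumr; apply: eq_bigr => r _.
rewrite scaler_sumr; apply: eq_bigr => s _.
rewrite scaler_sumr; apply: eq_bigr => t _ /=.
by rewrite -pzscalerAl -scalerMnr !scalerA mulrC.
Qed.

Lemma hurwitz_prodZr c f g n : H f (c \*: g) n = c *: H f g n.
Proof.
rewrite scaler_sumr; apply: eq_bigr => r _.
rewrite scaler_sumr; apply: eq_bigr => s _.
rewrite scaler_sumr; apply: eq_bigr => t _ /=.
by rewrite -pzscalerAr -scalerMnr !scalerA mulrC.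
Qed.

Definition hurwitz_one (n : nat) : A := (n == 0)%:R.

Lemma hurwitz_prod0l f n : H (fun=> 0) f n = 0.
Proof.
rewrite /hurwitz_prod big1 // => r _; rewrite big1 // => s _.
by rewrite big1 // => t _; rewrite mul0r scaler0 mul0rn.
Qed.

Lemma hurwitz_prod1l f n : H hurwitz_one f n = f n.
Proof.
elim: n f => [|n IHn] f; first by rewrite hurwitz_prod_at0 mul1r.
by rewrite hurwitz_prodS IHn !hurwitz_prod0l scaler0 addr0 add0r.
Qed.

Lemma hurwitz_prod0r f n : H f (fun=> 0) n = 0.
Proof.
rewrite /hurwitz_prod big1 // => r _; rewrite big1 // => s _.
by rewrite big1 // => t _; rewrite mulr0 scaler0 mul0rn.
Qed.

Lemma hurwitz_prod1r f n : H f hurwitz_one n = f n.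
Proof.
elim: n f => [|n IHn] f; first by rewrite hurwitz_prod_at0 mulr1.
by rewrite hurwitz_prodS IHn !hurwitz_prod0r scaler0 !addr0.
Qed.

Lemma hurwitz_prod_shift f g : H f g \o succn =
  (H (f \o succn) g \+ H f (g \o succn)) \+
  (lambda \*: H (f \o succn) (g \o succn)).
Proof. by apply/funext => n /=; rewrite hurwitz_prodS. Qed.

Lemma hurwitz_prodA f g h n : H f (H g h) n = H (H f g) h n.
Proof.
elim: n f g h => [|n IHn] f g h; first by rewrite !hurwitz_prod_at0 mulrA.
rewrite !hurwitz_prodS !hurwitz_prod_shift.
rewrite !(hurwitz_prodDl, hurwitz_prodDr, hurwitz_prodZl, hurwitz_prodZr) !IHn.
rewrite !scalerDr !addrA.
by rewrite [RHS](ACl (1*2*4*6*3*5*7))%AC.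
Qed.

End HurwitzTheory.

Definition hurwitz (k : comPzRingType) (A : pzAlgebra k) (l : option nat)
  (lambda : k) : Type := sequence A l.

HB.instance Definition _ (k : comPzRingType) (A : pzAlgebra k) (l : option nat)
  (lambda : k) := GRing.Lmodule.copy (hurwitz A l lambda) (position l -> A).

Section Hurwitz.
Variables (k : comPzRingType) (A : pzAlgebra k) (l : option nat) (lambda : k).
Implicit Types a b c : hurwitz A l lambda.

Definition hurwitz_unit : hurwitz A l lambda := fun n => (n == 0 :> nat)%:R.

Definition hurwitz_mul a b : hurwitz A l lambda :=
  fun n => hurwitz_prod lambda (entry a) (entry b) n.

Let entryE (a : sequence A l) (n : position l) : entry a n = a n.
Proof. by rewrite /entry valK. Qed.

Let entry_below (a : sequence A l) (n : position l) (f : nat -> A) :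
    (forall i : position l, a i = f i) ->
  forall m, (m <= n)%N -> entry a m = f m.
Proof.
move=> af m le_mn; have bm : below l m.
  by case: n le_mn => n /=; case: l => //= q lt_nq le_mn; exact: leq_ltn_trans le_mn lt_nq.
by rewrite -[m]/(position_val (Sub m bm : position l)) entryE af.
Qed.

Let entryD a b : entry (a + b : hurwitz A l lambda) = entry a \+ entry b.
Proof.
by apply/funext => m; rewrite /entry /=; case: insubP => //= _; rewrite addr0.
Qed.

Let entryZ (c : k) a : entry (c *: a : hurwitz A l lambda) = c \*: entry a.
Proof.
by apply/funext => m; rewrite /entry /=; case: insubP => //= _; rewrite scaler0.
Qed.

Let hurwitz_mulA : associative hurwitz_mul.
Proof.
move=> a b c; apply/funext => n; rewrite /hurwitz_mul.
transitivity (hurwitz_prod lambda (entry a) (hurwitz_prod lambda (entry b) (entry c)) n).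
  by apply: eq_hurwitz_prod => // m; apply: entry_below.
rewrite hurwitz_prodA; apply/esym/eq_hurwitz_prod => // m; exact: entry_below.
Qed.

Let hurwitz_mul1l : left_id hurwitz_unit hurwitz_mul.
Proof.
move=> a; apply/funext => n; rewrite /hurwitz_mul -[RHS]entryE.
rewrite -(hurwitz_prod1l lambda (entry a)).
by apply: eq_hurwitz_prod => // m; apply: entry_below.
Qed.

Let hurwitz_mul1r : right_id hurwitz_unit hurwitz_mul.
Proof.
move=> a; apply/funext => n; rewrite /hurwitz_mul -[RHS]entryE.
rewrite -(hurwitz_prod1r lambda (entry a)).
by apply: eq_hurwitz_prod => // m; apply: entry_below.
Qed.

Let hurwitz_mulDl : left_distributive hurwitz_mul +%R.
Proof.
by move=> a b c; apply/funext => n; rewrite /hurwitz_mul entryD hurwitz_prodDl.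
Qed.

Let hurwitz_mulDr : right_distributive hurwitz_mul +%R.
Proof.
by move=> a b c; apply/funext => n; rewrite /hurwitz_mul entryD hurwitz_prodDr.
Qed.

HB.instance Definition _ := GRing.Zmodule_isPzRing.Build (hurwitz A l lambda)
  hurwitz_mulA hurwitz_mul1l hurwitz_mul1r hurwitz_mulDl hurwitz_mulDr.

Let hurwitz_scaleAl (c : k) a b : c *: (a * b) = c *: a * b.
Proof.
by apply/funext => n; rewrite /GRing.mul /= /hurwitz_mul entryZ hurwitz_prodZl.
Qed.

Let hurwitz_scaleAr (c : k) a b : c *: (a * b) = a * (c *: b).
Proof.
by apply/funext => n; rewrite /GRing.mul /= /hurwitz_mul entryZ hurwitz_prodZr.
Qed.

Definition hurwitz_alg : pzAlgebra k :=
  PzAlgebra (@AlgebraStructure k (hurwitz A l lambda)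
    (GRing.Nmodule_isLSemiModule.Build k (hurwitz A l lambda)
      (@scalerA _ _) (@scale0r _ _) (@scale1r _ _) (@scalerDr _ _) (@scalerDl _ _))
    hurwitz_scaleAl hurwitz_scaleAr).

Let pointwise_scaleAl (c : k) (a b : position l -> A) : c *: (a * b) = c *: a * b.
Proof. by apply/funext => n; exact: pzscalerAl. Qed.

Let pointwise_scaleAr (c : k) (a b : position l -> A) : c *: (a * b) = a * (c *: b).
Proof. by apply/funext => n; exact: pzscalerAr. Qed.

(* The ring and module structures on functions are those of mathcomp.classical. *)
Definition pointwise_alg : pzAlgebra k :=
  PzAlgebra (@AlgebraStructure k (position l -> A)
    (GRing.Nmodule_isLSemiModule.Build k (position l -> A)
      (@scalerA _ _) (@scale0r _ _) (@scale1r _ _) (@scalerDr _ _) (@scalerDl _ _))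
    pointwise_scaleAl pointwise_scaleAr).

End Hurwitz.

(* Main.v *)
(* The binomial transform (T_c f)_n = sum_m C(n,m) c^(n-m) f_m satisfies
   T_c T_d = T_(c+d) and T_0 = id, so theta = T_1 is inverted by T_(-1).
   Multiplicativity of T_1 follows by induction on n from Pascal's rule and the
   Leibniz rule for the shift.  The map gamma is theta composed with lambda-hat,
   and the latter is inverted by rescaling with the inverse of lambda. *)

Require Import Defs.
From HB Require Import structures.
From mathcomp Require Import all_boot all_algebra.
From mathcomp Require Import boolp functions.
Local Open Scope ring_scope.

Import GRing.Theory.

(** Formally, this multiplies the exponential generating function of [f] by exp(c x), whence the
    additive law in [c]. *)
Definition binomial_transform (k : comPzRingType) (V : lmodType k) (c : k)
    (f : nat -> V) (n : nat) : V :=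
  \sum_(m < n.+1) (c ^+ (n - m) *: f m) *+ 'C(n, m).

Section BinomialTransform.
Variables (k : comPzRingType) (V : lmodType k).
Implicit Types (c d : k) (f g : nat -> V) (n : nat).
Local Notation T := (binomial_transform k V).

Lemma binomial_transform_at0 c f : T c f 0 = f 0.
Proof. by rewrite /binomial_transform big_ord1 bin0 expr0 scale1r. Qed.

(** Pascal's rule: the 'C(n, m - 1) half gives the shifted sequence, the 'C(n, m) half keeps [f]
    with one more factor [c]. *)
Lemma binomial_transformS c f n :
  T c f n.+1 = T c (f \o succn) n + c *: T c f n.
Proof.
rewrite /binomial_transform big_ord_recl /=.
under eq_bigr => i _ do rewrite /bump /= add1n subSS binS mulrnDr addrC.
rewrite big_split /= addrCA; congr (_ + _).
(* The top term carries 'C(n, n + 1) = 0. *)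
rewrite big_ord_recr /= (@bin_small n n.+1) // mulr0n addr0 scaler_sumr.
rewrite [RHS]big_ord_recl /= !bin0 !subn0 !mulr1n scalerA -exprS.
congr (_ + _); apply: eq_bigr => i _; rewrite /bump /= add1n.
by rewrite -scalerMnr scalerA -exprS -subSn ?subSS.
Qed.

Lemma binomial_transform_linear c d f g n :
  T c (d \*: f \+ g) n = d *: T c f n + T c g n.
Proof.
rewrite scaler_sumr -big_split; apply: eq_bigr => m _ /=.
by rewrite scalerDr mulrnDl -scalerMnr !scalerA (mulrC d).
Qed.

Lemma eq_binomial_transform c f g n :
  (forall m, (m <= n)%N -> f m = g m) -> T c f n = T c g n.
Proof. by move=> fg; apply: eq_bigr => m _; rewrite fg // -ltnS. Qed.

(** With S the shift, the recursion reads S T_c = T_c (S + c). Hence S T_c T_d = T_c T_d (S + c +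
    d), the recursion of T_(c+d), with the same value at 0. *)
Lemma binomial_transform_comp c d f n : T c (T d f) n = T (c + d) f n.
Proof.
elim: n f => [|n IHn] f; first by rewrite !binomial_transform_at0.
rewrite !binomial_transformS -!IHn.
have -> : T d f \o succn = d \*: T d f \+ T d (f \o succn).
  by apply/funext => m /=; rewrite binomial_transformS addrC.
by rewrite binomial_transform_linear addrAC scalerDl [RHS]addrC (addrC (c *: _)).
Qed.

Lemma binomial_transform0 f n : T 0 f n = f n.
Proof.
elim: n f => [|n IHn] f; first by rewrite binomial_transform_at0.
by rewrite binomial_transformS IHn scale0r addr0.
Qed.

End BinomialTransform.

Section HurwitzProd.
Variables (k : comPzRingType) (A : pzAlgebra k).
Implicit Types (c d : k) (f g : nat -> A) (n : nat).

(* Both sides satisfy the same recursion: with f' the shift of f, the Leibniz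
   rule (f g)' = f' g + f g' + f' g' gives
   T(f g) + T((f g)') = (T f + T f') (T g + T g'). *)
Lemma binomial_transform_hurwitz_prod f g n :
  binomial_transform k A 1 (hurwitz_prod 1 f g) n =
  binomial_transform k A 1 f n * binomial_transform k A 1 g n.
Proof.
elim: n f g => [|n IHn] f g.
  by rewrite !binomial_transform_at0 hurwitz_prod_at0.
rewrite !binomial_transformS hurwitz_prod_shift !scale1r.
(* The coefficients 1 give the sum the shape that [binomial_transform_linear] expects. *)
have -> : forall u v w : nat -> A,
    u \+ v \+ 1 \*: w = 1 \*: u \+ (1 \*: v \+ w).
  by move=> u v w; apply/funext => m /=; rewrite !scale1r addrA.
rewrite !binomial_transform_linear !scale1r !IHn mulrDl !mulrDr !addrA.
by rewrite [LHS](ACl (3*1*2*4))%AC.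
Qed.

Lemma binomial_transform_hurwitz_one n :
  binomial_transform k A 1 (hurwitz_one A) n = 1.
Proof.
rewrite /binomial_transform big_ord_recl /= /hurwitz_one big1 => [|i _].
  by rewrite bin0 expr1n scale1r addr0.
by rewrite scaler0 mul0rn.
Qed.

(** In each term n = r + s + t, and the extra c^t from the weight completes c^n to c^(r+t) c^(s+t),
    one power for each factor. *)
Lemma hurwitz_prod_rescale c d f g n :
  c ^+ n *: hurwitz_prod (c * d) f g n =
  hurwitz_prod d (fun i => c ^+ i *: f i) (fun i => c ^+ i *: g i) n.
Proof.
rewrite scaler_sumr; apply: eq_bigr => r _.
rewrite scaler_sumr; apply: eq_bigr => s _.
rewrite scaler_sumr; apply: eq_bigr => t /eqP rst.
have -> : c ^+ n = c ^+ (r + s + t) by rewrite rst.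
rewrite -scalerMnr -pzscalerAl -pzscalerAr !scalerA. congr (_ *: _ *+ _).
by rewrite exprMn !exprD !mulrA [LHS](ACl (5*1*3*2*4))%AC.
Qed.

End HurwitzProd.

Section Sequences.
Variables (k : comPzRingType) (A : pzAlgebra k) (l : option nat).

Lemma entryE (a : sequence A l) (n : position l) : entry a n = a n.
Proof. by rewrite /entry valK. Qed.

(** Positions are closed downwards, so the default value 0 of [entry] is never met up to [n]. This
    carries identities on [nat -> A] over to truncated sequences. *)
Lemma eq_entry (a : sequence A l) (f : nat -> A) (n : position l) :
    (forall i : position l, a i = f i) ->
  forall m, (m <= n)%N -> entry a m = f m.
Proof.
move=> af m le_mn; have bm : below l m.
  case: n le_mn => n /=; case: l => //= q lt_nq le_mn.
  exact: leq_ltn_trans le_mn lt_nq.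
by rewrite -[m]/(position_val (Sub m bm : position l)) entryE af.
Qed.

Lemma entry_linear (c : k) (a b : position l -> A) :
  entry (c *: a + b : sequence A l) = c \*: entry a \+ entry b.
Proof.
apply/funext => m; rewrite /entry /=; case: insubP => //= _.
by rewrite scaler0 addr0.
Qed.

Lemma hurwitz_algZD lambda (c : k) (a b : hurwitz_alg A l lambda) :
  c *: a + b = (fun n => c *: a n + b n) :> (position l -> A).
Proof. by []. Qed.

Lemma hurwitz_algM lambda (a b : hurwitz_alg A l lambda) :
  a * b = (fun n => hurwitz_prod lambda (entry a) (entry b) n)
    :> (position l -> A).
Proof. by []. Qed.

Lemma hurwitz_alg1 lambda :
  (1 : hurwitz_alg A l lambda) = (fun n => hurwitz_one A n)
    :> (position l -> A).
Proof. by []. Qed.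

(** Both weights are left free, so that the inverse rescaling is an instance too. *)
Definition rescale lambda mu (c : k) (a : hurwitz_alg A l lambda) :
  hurwitz_alg A l mu := fun n => c ^+ n *: a n.

End Sequences.

Section Morphisms.
Variable k : comPzRingType.
Implicit Types A B C : pzAlgebra k.

Lemma is_algebra_morphism_comp A B C (f : A -> B) (g : B -> C) :
    is_algebra_morphism f -> is_algebra_morphism g ->
  is_algebra_morphism (g \o f).
Proof.
move=> [lf [f1 fM]] [lg [g1 gM]]; split; first by move=> c x y /=; rewrite lf lg.
by split=> [|x y] /=; rewrite ?f1 ?g1 // fM gM.
Qed.

(** The inverse is automatically a morphism: apply the injective [f] to each required identity. *)
Lemma is_algebra_isomorphism_can A B (f : A -> B) (g : B -> A) :
  is_algebra_morphism f -> cancel f g -> cancel g f -> is_algebra_isomorphism f.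
Proof.
move=> mf fK gK; split=> //; exists g; split=> //.
case: mf => lf [f1 fM]; split; first move=> c x y.
  by apply: (can_inj fK); rewrite lf !gK.
by split=> [|x y]; apply: (can_inj fK); rewrite ?fM !gK.
Qed.

Lemma is_algebra_isomorphism_comp A B C (f : A -> B) (g : B -> C) :
    is_algebra_isomorphism f -> is_algebra_isomorphism g ->
  is_algebra_isomorphism (g \o f).
Proof.
move=> [mf [f' [_ fK f'K]]] [mg [g' [_ gK g'K]]].
apply: (is_algebra_isomorphism_can A C (g \o f) (f' \o g')).
- exact: is_algebra_morphism_comp.
- exact: can_comp.
- exact: can_comp.
Qed.

End Morphisms.

Section HurwitzMorphisms.
Variables (k : comPzRingType) (A : pzAlgebra k) (l : option nat).

Lemma rescale_morphism (c mu lambda : k) : lambda = c * mu ->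
  is_algebra_morphism (rescale k A l lambda mu c).
Proof.
move=> ->; split.
  move=> d a b; apply/funext => n.
  by rewrite /rescale !hurwitz_algZD scalerDr !scalerA mulrC.
split=> [|a b]; apply/funext => n; rewrite /rescale.
  rewrite !hurwitz_alg1 /hurwitz_one; case: eqP => [->|_]; last exact: scaler0.
  by rewrite expr0 scale1r.
rewrite !hurwitz_algM hurwitz_prod_rescale.
by apply: eq_hurwitz_prod => m le_mn; apply/esym; move: m le_mn;
  apply: eq_entry => i; rewrite entryE.
Qed.

Lemma rescale_can (c d lambda mu : k) : d * c = 1 ->
  cancel (rescale k A l lambda mu c) (rescale k A l mu lambda d).
Proof.
move=> dc a; apply/funext => n; rewrite /rescale scalerA -exprMn dc.
by rewrite expr1n scale1r.
Qed.

Definition hurwitz_theta (a : hurwitz_alg A l 1) : pointwise_alg A l :=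
  fun n => binomial_transform k A 1 (entry a) n.

Definition hurwitz_theta_inv (a : pointwise_alg A l) : hurwitz_alg A l 1 :=
  fun n => binomial_transform k A (- 1) (entry a) n.

Lemma hurwitz_theta_morphism : is_algebra_morphism hurwitz_theta.
Proof.
split.
  move=> c a b; apply/funext => n.
  by rewrite /hurwitz_theta entry_linear binomial_transform_linear.
split=> [|a b]; apply/funext => n; rewrite /hurwitz_theta.
  rewrite -[RHS](binomial_transform_hurwitz_one k A n).
  by apply: eq_binomial_transform; apply: eq_entry.
rewrite -[RHS]binomial_transform_hurwitz_prod.
by apply: eq_binomial_transform; apply: eq_entry.
Qed.

Lemma hurwitz_theta_isomorphism : is_algebra_isomorphism hurwitz_theta.
Proof.
apply: (is_algebra_isomorphism_can _ _ _ hurwitz_theta hurwitz_theta_inv).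
- exact: hurwitz_theta_morphism.
- move=> a; apply/funext => n; rewrite -[RHS]entryE.
  (* The identity is read as T_0 with 0 = -1 + 1, then split into T_(-1) T_1. *)
  rewrite -(binomial_transform0 _ _ (entry a) n) -(addNr 1).
  rewrite -binomial_transform_comp.
  by apply: eq_binomial_transform; apply: eq_entry.
- move=> a; apply/funext => n; rewrite -[RHS]entryE.
  rewrite -(binomial_transform0 _ _ (entry a) n) -(subrr 1).
  rewrite -binomial_transform_comp.
  by apply: eq_binomial_transform; apply: eq_entry.
Qed.

Lemma hurwitz_thetaE (a : hurwitz_alg A l 1) (n : position l) :
  hurwitz_theta a n = \sum_(m < n.+1) entry a m *+ 'C(n, m).
Proof. by apply: eq_bigr => m _; rewrite expr1n scale1r. Qed.

End HurwitzMorphisms.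

Theorem proposition3p1 (k : comPzRingType) (kQ : algebra_structure rat k)
    (lambda : k) (A : pzAlgebra k) (l : option nat) :
  (exists hat_lambda : hurwitz_alg A l lambda -> hurwitz_alg A l 1,
      is_algebra_morphism hat_lambda /\
      forall (a : hurwitz_alg A l lambda) (n : position l),
        hat_lambda a n = lambda ^+ n *: a n)
  /\
  (exists theta : hurwitz_alg A l 1 -> pointwise_alg A l,
      is_algebra_isomorphism theta /\
      forall (a : hurwitz_alg A l 1) (n : position l),
        theta a n = \sum_(m < n.+1) entry a m *+ 'C(n, m))
  /\
  (exists gamma : hurwitz_alg A l lambda -> pointwise_alg A l,
      [/\ is_algebra_morphism gamma,
          (forall (a : hurwitz_alg A l lambda) (n : position l),
             gamma a n = \sum_(m < n.+1) (lambda ^+ m *: entry a m) *+ 'C(n, m))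
        & (exists mu : k, lambda * mu = 1 /\ mu * lambda = 1) ->
          is_algebra_isomorphism gamma]).
Proof.
pose hat := rescale k A l lambda 1 lambda.
pose theta := hurwitz_theta k A l.
have hatP : is_algebra_morphism hat.
  (* The weight factors as [lambda * 1]: scale factor [lambda], target weight 1. *)
  by apply: rescale_morphism; rewrite mulr1.
split; first by exists hat.
split.
  exists theta; split; first exact: hurwitz_theta_isomorphism.
  exact: hurwitz_thetaE.
exists (theta \o hat); split.
- by apply: is_algebra_morphism_comp => //; exact: hurwitz_theta_morphism.
- move=> a n; rewrite [LHS]hurwitz_thetaE; apply: eq_bigr => m _.
  congr (_ *+ _); have le_mn : (m <= n)%N by rewrite -ltnS.
  rewrite (eq_entry k A l (hat a) (fun i => lambda ^+ i *: entry a i) n) //.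
  by move=> i; rewrite entryE.
- move=> [mu [lambda_mu mu_lambda]].
  apply: is_algebra_isomorphism_comp; last exact: hurwitz_theta_isomorphism.
  (* The two cancellations use [mu * lambda = 1] and [lambda * mu = 1] respectively. *)
  apply: (is_algebra_isomorphism_can _ _ _ hat (rescale k A l 1 lambda mu)) => //.
    exact: rescale_can.
  exact: rescale_can.
Qed.
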